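(* Let $\Gamma$ be a negative definite star-shaped plumbing graph with $d\ge3$ legs, all genera zero, with normalized Seifert invariants $(-b_0,0;(\alpha_i,\omega_i)_{i=1}^d)$, and let $M$ be the associated Seifert rational homology sphere. Let $\check{s}$ be the $E_0$-coefficient of the cycle $s_{[Z_K+E_0^*]}$. If $b_0<d$, then the Frobenius number of $\mathcal{S}_M$ is $$f_{\mathcal{S}_M}=\gamma+\frac{1}{|e|}-\check{s}.$$
   Context: Star-shaped graph: integers $b_0$ and coprime pairs $(\alpha_i,\omega_i)$ with $0<\omega_i<\alpha_i$, $1\le i\le d$, are given. The graph $\Gamma$ has a central vertex $v_0$ with decoration $-b_0$ and $d$ legs; writing $\alpha_i/\omega_i=b_{i1}-1/(b_{i2}-1/(\cdots-1/b_{i\nu_i}))$ with all $b_{ij}\ge2$, the $i$-th leg is a chain of vertices $v_{i1},\dots,v_{i\nu_i}$ with decorations $-b_{i1},\dots,-b_{i\nu_i}$, and $v_{i1}$ is joined to $v_0$. The vertex set is $\mathcal{V}$. $L$ is the free abelian group on $\{E_v\}_{v\in\mathcal{V}}$ with the symmetric form in which $(E_v,E_v)$ is the decoration of $v$, $(E_v,E_w)=1$ if $v\neq w$ are adjacent, and $0$ otherwise; write $E_0=E_{v_0}$. The form is negative definite if and only if $e:=-b_0+\sum_i\omega_i/\alpha_i<0$, which is assumed. $L':=\{l'\in L\otimes\mathbb{Q}:(l',l)\in\mathbb{Z}\ \text{for all } l\in L\}$, $H:=L'/L$, and $[l']$ is the class of $l'$ in $H$. $E_v^*\in L'$ is defined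 by $(E_v^*,E_v)=-1$ and $(E_v^*,E_w)=0$ for $w\ne v$; $E_0^*:=E_{v_0}^*$. $Z_K\in L'$ is defined by $(Z_K,E_v)=(E_v,E_v)+2$ for all $v\in\mathcal{V}$. The order on $L\otimes\mathbb{Q}$ is coefficientwise. For $h\in H$, $s_h$ is the unique minimal element (with respect to this order) of $\{l'\in L':[l']=h,\ (l',E_v)\le0\ \text{for all } v\in\mathcal{V}\}$. $\gamma:=\frac{1}{|e|}\big(d-2-\sum_{i=1}^d\frac1{\alpha_i}\big)$. $N(\ell):=b_0\ell-\sum_{i=1}^d\lceil\ell\omega_i/\alpha_i\rceil$ for $\ell\in\mathbb{Z}$, $\mathcal{S}_M:=\{\ell\in\mathbb{Z}:N(\ell)\ge0\}$ (a numerical semigroup in $\mathbb{Z}_{\ge0}$), and $f_{\mathcal{S}_M}$ is the largest integer not in $\mathcal{S}_M$. *)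

(* Defs.v *)
From mathcomp Require Import all_boot all_order all_algebra.

Set Implicit Arguments.
Unset Strict Implicit.
Unset Printing Implicit Defensive.

Import Order.TTheory GRing.Theory Num.Theory.
Local Open Scope ring_scope.

(* A lattice L = Z<E_v : v in V> is given by its intersection matrix
   A v w = (E_v, E_w). The space L (x) Q is {ffun V -> rat}, a cycle
   \sum_v x_v E_v being the function v |-> x_v; L and L' are predicates on it. *)

Definition base_cycle (V : finType) (v : V) : {ffun V -> rat} :=
  [ffun w => (w == v)%:R].

Definition pairing (V : finType) (A : V -> V -> int) (x y : {ffun V -> rat}) :
    rat :=
  \sum_v \sum_w x v * y w * (A v w)%:~R.

Definition in_lattice (V : finType) (x : {ffun V -> rat}) : Prop :=
  forall v, x v \is a Num.int.

Definition negative_definite (V : finType) (A : V -> V -> int) : Prop :=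
  forall x : {ffun V -> rat}, in_lattice x -> x <> 0 -> pairing A x x < 0.

Definition in_dual (V : finType) (A : V -> V -> int) (x : {ffun V -> rat}) :
    Prop :=
  forall y, in_lattice y -> pairing A x y \is a Num.int.

(* The elements of H = L'/L are represented as cosets, i.e. as predicates on
   L (x) Q; this is the coset [x]. *)
Definition dual_class (V : finType) (A : V -> V -> int) (x : {ffun V -> rat}) :
    {ffun V -> rat} -> Prop :=
  fun y => in_dual A y /\ in_lattice (y - x).

Definition is_dual_base (V : finType) (A : V -> V -> int) (v : V)
    (x : {ffun V -> rat}) : Prop :=
  in_dual A x /\
  forall w, pairing A x (base_cycle w) = if w == v then -1 else 0.

(* Z_K is minus the canonical class, so the adjunction formula has this sign. *)
Definition is_anticanonical (V : finType) (A : V -> V -> int)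
    (x : {ffun V -> rat}) : Prop :=
  in_dual A x /\
  forall v, pairing A x (base_cycle v)
            = pairing A (base_cycle v) (base_cycle v) + 2.

Definition cycle_le (V : finType) (x y : {ffun V -> rat}) : Prop :=
  forall v, x v <= y v.

Definition minimal_in (V : finType) (P : {ffun V -> rat} -> Prop)
    (x : {ffun V -> rat}) : Prop :=
  P x /\ forall y, P y -> cycle_le y x -> y = x.

Definition antinef_in (V : finType) (A : V -> V -> int)
    (h : {ffun V -> rat} -> Prop) (x : {ffun V -> rat}) : Prop :=
  [/\ in_dual A x, h x & forall v, pairing A x (base_cycle v) <= 0].

(* s is the cycle s_h of the class h *)
Definition is_min_antinef (V : finType) (A : V -> V -> int)
    (h : {ffun V -> rat} -> Prop) (s : {ffun V -> rat}) : Prop :=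
  unique (minimal_in (antinef_in A h)) s.

(* b_1 - 1/(b_2 - 1/(... - 1/b_n)). Since 0^-1 = 0, a one-term sequence has
   value b_1; the empty sequence has value 0. *)
Fixpoint neg_cont_frac (s : seq int) : rat :=
  if s is b :: s' then b%:~R - (neg_cont_frac s')^-1 else 0.

(* None is v_0, and Some (i, j) with both indices starting from 0 is the j-th
   vertex of the i-th leg, counted from the centre; leg i is the sequence
   b_{i1}, ..., b_{i nu_i}. *)
Definition star_vertex (d : nat) (leg : 'I_d -> seq int) : finType :=
  option {i : 'I_d & 'I_(size (leg i))}.

Definition star_deco (d : nat) (b0 : int) (leg : 'I_d -> seq int)
    (v : star_vertex leg) : int :=
  if v is Some p then - (leg (tag p))`_(tagged p) else - b0.

Definition star_adj (d : nat) (leg : 'I_d -> seq int)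
    (v w : star_vertex leg) : bool :=
  match v, w with
  | None, None => false
  | None, Some p | Some p, None => tagged p == 0%N :> nat
  | Some p, Some q =>
      (tag p == tag q) &&
      (((tagged p).+1 == tagged q :> nat) || ((tagged q).+1 == tagged p :> nat))
  end.

Definition star_form (d : nat) (b0 : int) (leg : 'I_d -> seq int)
    (v w : star_vertex leg) : int :=
  if v == w then star_deco b0 v else if star_adj v w then 1 else 0.

Definition star_center (d : nat) (leg : 'I_d -> seq int) : star_vertex leg :=
  None.

Definition orbifold_euler (d : nat) (b0 : int) (alpha omega : 'I_d -> nat) :
    rat :=
  - b0%:~R + \sum_i (omega i)%:R / (alpha i)%:R.

Definition seifert_gamma (d : nat) (b0 : int) (alpha omega : 'I_d -> nat) :
    rat :=
  `|orbifold_euler b0 alpha omega|^-1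
  * (d%:R - 2 - \sum_i (alpha i)%:R^-1).

Definition seifert_N (d : nat) (b0 : int) (alpha omega : 'I_d -> nat)
    (l : int) : int :=
  b0 * l - \sum_i Num.ceil (l%:~R * (omega i)%:R / (alpha i)%:R : rat).

Definition seifert_semigroup (d : nat) (b0 : int) (alpha omega : 'I_d -> nat)
    (l : int) : Prop :=
  0 <= seifert_N b0 alpha omega l.

Definition is_frobenius_number (S : int -> Prop) (f : int) : Prop :=
  ~ S f /\ forall l, ~ S l -> l <= f.

(* Main.v *)
Require Import Defs.
From mathcomp Require Import all_boot all_order all_algebra.
From mathcomp Require Import ring lra.

Set Implicit Arguments.
Unset Strict Implicit.
Unset Printing Implicit Defensive.

Import Order.TTheory GRing.Theory Num.Theory.
Local Open Scope ring_scope.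

(** Write D for the dual cycle E_0^* and c for Z_K + D. The cycles of the class
    of c are c - l with l integral, and since (c, E_v) is known for every v,
    such a cycle is antinef exactly when (l, E_v) is at least E_v^2 + 2, or
    E_v^2 + 1 at the central vertex [adjunction_bounded]. Antinef cycles of a
    class are closed under minimum [min_antinef_le], so the least one
    corresponds to the largest possible E_0-coefficient of l.

    Subtract 1 from all coefficients of l, say k = l - 1, and extend k by the
    value -1 past the end of every leg. The conditions on the legs become the
    homogeneous inequalities b_j k_j <= k_(j-1) + k_(j+1), and eliminating a
    leg from its end, with the continued fraction providing the multipliers,
    turns them into alpha_i k_(i1) <= omega_i k_0 - 1 [leg_ineq]. For integers
    this says that k_(i1) + 1 is at most the ceiling of k_0 omega_i / alpha_i,
    and every such k_(i1) extends to an admissible leg, because one can run the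
    recursion with equalities outwards. The condition at the centre then reads
    N(k_0) <= -1. So k_0 is the E_0-coefficient minus 1 of an admissible l if
    and only if k_0 is not in the semigroup [bounded_lattice_coef,
    exists_bounded_lattice]: the largest gap is c_0 - s_0 - 1, where s is the
    least antinef cycle.

    It remains to compute c_0. The same elimination with equalities in place of
    inequalities gives, for the E_0-coefficients, e (Z_K)_0 = e - |e| gamma
    and e D_0 = -1 [anticanonical_center, dual_center]. The latter, together
    with (D, D) = - D_0 < 0, also gives e < 0, hence (Z_K)_0 = 1 + gamma,
    D_0 = 1 / |e| and c_0 - s_0 - 1 = gamma + 1 / |e| - s_0. *)

(** * Antinef cycles of a lattice *)

Section Lattice.
Variables (V : finType) (A : V -> V -> int).
Implicit Types x y c s : {ffun V -> rat}.

Lemma pairing_base x v :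
  pairing A x (base_cycle v) = \sum_w x w * (A w v)%:~R.
Proof.
apply: eq_bigr => w _; rewrite (bigD1 v) //= ffunE eqxx mulr1 big1 ?addr0 //.
by move=> u /negPf neq_uv; rewrite ffunE neq_uv mulr0 mul0r.
Qed.

Lemma pairing_baseE x y :
  pairing A x y = \sum_v y v * pairing A x (base_cycle v).
Proof.
rewrite /pairing exchange_big; apply: eq_bigr => v _ /=.
rewrite -/(pairing A x (base_cycle v)) pairing_base mulr_sumr.
by apply: eq_bigr => w _; rewrite -!mulrA mulrCA.
Qed.

Lemma pairingD x y z : pairing A (x + y) z = pairing A x z + pairing A y z.
Proof.
rewrite -big_split; apply: eq_bigr => v _; rewrite -big_split.
by apply: eq_bigr => w _; rewrite ffunE !mulrDl.
Qed.

Lemma pairingN x z : pairing A (- x) z = - pairing A x z.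
Proof.
rewrite -sumrN; apply: eq_bigr => v _; rewrite -sumrN.
by apply: eq_bigr => w _; rewrite ffunE !mulNr.
Qed.

Lemma lattice_in_dual x : in_lattice x -> in_dual A x.
Proof.
move=> xZ y yZ; apply: rpred_sum => v _; apply: rpred_sum => w _.
by rewrite !rpredM ?rpred_int ?intr_int.
Qed.

Lemma in_dualD x y : in_dual A x -> in_dual A y -> in_dual A (x + y).
Proof. by move=> xD yD z zZ; rewrite pairingD rpredD ?xD ?yD. Qed.

(** Definiteness is a condition on integral cycles only; a rational cycle
    becomes integral after multiplication by its denominators. *)
Lemma negative_definite_rat x :
  negative_definite A -> x <> 0 -> pairing A x x < 0.
Proof.
move=> negA x0; pose D : rat := \prod_v (denq (x v))%:~R.
have D_gt0 : 0 < D by apply: prodr_gt0 => v _; rewrite ltr0z denq_gt0.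
pose y : {ffun V -> rat} := [ffun v => D * x v].
have yZ : in_lattice y.
  move=> v; rewrite ffunE /D (bigD1 v) //= mulrC mulrA.
  rewrite -{1}[x v]divq_num_den mulfVK ?intr_eq0 ?denq_neq0 //.
  by rewrite rpredM ?intr_int // rpred_prod // => w _; apply: intr_int.
have y0 : y <> 0.
  move=> y0; apply: x0; apply/ffunP => v; rewrite ffunE.
  have /ffunP/(_ v) := y0; rewrite !ffunE => /eqP.
  by rewrite mulf_eq0 gt_eqF //= => /eqP.
have -> : pairing A x x = pairing A y y / D ^+ 2.
  rewrite /pairing mulr_suml; apply: eq_bigr => v _; rewrite mulr_suml.
  apply: eq_bigr => w _; rewrite !ffunE; field; exact: lt0r_neq0.
by rewrite pmulr_llt0 ?negA // invr_gt0 exprn_gt0.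
Qed.

(** At a vertex where the minimum is attained by x, only the neighbouring
    coefficients may decrease, and these enter with nonnegative weights. *)
Lemma minr_pairing_le x y v :
  (forall w, w != v -> 0 <= A w v) -> x v <= y v ->
  pairing A [ffun w => Num.min (x w) (y w)] (base_cycle v)
  <= pairing A x (base_cycle v).
Proof.
move=> Age0 le_xy; rewrite !pairing_base; apply: ler_sum => w _; rewrite ffunE.
have [->|neq_wv] := eqVneq w v; first by rewrite min_l.
by rewrite ler_wpM2r ?ler0z ?Age0 // ge_min lexx.
Qed.

(** Antinef cycles of a class are stable under coefficientwise minimum,
    hence an antinef cycle which is minimal is the least one. *)
Lemma min_antinef_le c s x :
  (forall v w, w != v -> 0 <= A w v) ->
  is_min_antinef A (dual_class A c) s -> antinef_in A (dual_class A c) x ->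
  cycle_le s x.
Proof.
move=> Age0 [[[sD [_ scZ] sN] smin] _] [xD [_ xcZ] xN].
pose m : {ffun V -> rat} := [ffun w => Num.min (s w) (x w)].
have msZ : in_lattice (m - s).
  move=> w; rewrite !ffunE minEle; case: ifP => _.
    by rewrite subrr rpred0.
  have -> : x w - s w = (x - c) w - (s - c) w by rewrite !ffunE; ring.
  by rewrite rpredB ?xcZ ?scZ.
have mD : in_dual A m.
  by rewrite -(subrK s m); apply: in_dualD => //; apply: lattice_in_dual.
have mE : m = s.
  apply: smin; last by move=> w; rewrite ffunE ge_min lexx.
  split=> //; first split=> // w.
    have -> : (m - c) w = (m - s) w + (s - c) w by rewrite !ffunE; ring.
    by rewrite rpredD ?msZ ?scZ.
  move=> v; have [le_sx|/ltW le_xs] := leP (s v) (x v).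
    by apply: le_trans (sN v); apply: minr_pairing_le => // w; apply: Age0.
  apply: le_trans (xN v); suff -> : m = [ffun w => Num.min (x w) (s w)].
    by apply: minr_pairing_le => // w; apply: Age0.
  by apply/ffunP => w; rewrite !ffunE minC.
by move=> w; rewrite -mE ffunE ge_min lexx orbT.
Qed.

End Lattice.

(** * Negative continued fractions and linear recursions along a leg *)

(** The continued fraction as an unevaluated fraction: unlike its value, it
    remains meaningful on the empty sequence, where it is 1/0, and this makes
    the inductions below start at the end of the leg. *)
Fixpoint cf_pair (s : seq int) : int * int :=
  if s is b :: s' then (b * (cf_pair s').1 - (cf_pair s').2, (cf_pair s').1)
  else (1, 0).

Lemma cf_pair_bounds s : all (fun b : int => 2 <= b) s ->
  0 <= (cf_pair s).2 < (cf_pair s).1.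
Proof.
elim: s => //= b s IHs /andP[b2 /IHs/andP[q0 qp]].
by rewrite (ltW (le_lt_trans q0 qp)) /=; nra.
Qed.

Lemma cf_pair_coprime s : coprimez (cf_pair s).1 (cf_pair s).2.
Proof.
elim: s => //= b s; rewrite /coprimez => /eqP <-; apply/eqP.
by rewrite gcdzC gcdzMDl gcdzN.
Qed.

Lemma neg_cont_frac_pair s : all (fun b : int => 2 <= b) s ->
  neg_cont_frac s = (cf_pair s).1%:~R / (cf_pair s).2%:~R.
Proof.
elim: s => [|b s IHs] /=; first by rewrite invr0 mulr0.
move=> /andP[_ s2]; have /andP[q0 qp] := cf_pair_bounds s2.
rewrite IHs // invf_div rmorphB rmorphM /= mulrBl mulfK //.
by rewrite intr_eq0 gt_eqF // (le_lt_trans q0).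
Qed.

(** Both sides are reduced fractions with positive denominator. *)
Lemma cf_pair_eq s (a w : nat) : all (fun b : int => 2 <= b) s ->
  coprime a w -> (0 < w < a)%N -> neg_cont_frac s = a%:R / w%:R ->
  cf_pair s = (a%:Z, w%:Z).
Proof.
move=> s2 aw /andP[w0 wa]; rewrite neg_cont_frac_pair // => E.
have /andP[q0 qp] := cf_pair_bounds s2.
have w0' : w%:Z != 0 by rewrite -lt0n.
have a0 : (a%:R : rat) != 0 by rewrite pnatr_eq0 -lt0n (ltn_trans w0).
have q0' : (cf_pair s).2 != 0.
  apply: contra_eq_neq E => ->; rewrite invr0 mulr0 eq_sym.
  by rewrite mulf_neq0 // invr_neq0 // pnatr_eq0 -lt0n.
have {}E : (cf_pair s).1%:~R / (cf_pair s).2%:~R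
           = a%:Z%:~R / w%:Z%:~R :> rat by [].
have cop : coprime `|(cf_pair s).1| `|(cf_pair s).2| := cf_pair_coprime s.
have cop' : coprime `|a%:Z| `|w%:Z| by rewrite !absz_nat.
have := congr1 denq E; rewrite !coprimeq_den // (negPf w0') (negPf q0').
have := congr1 numq E; rewrite !coprimeq_num //.
rewrite !gtr0_sg ?mul1r // ?(lt_def 0 (cf_pair s).2) ?q0' //.
by rewrite ger0_norm //; case: (cf_pair s) => /= p q -> ->.
Qed.

(** Elimination of a leg: the inequality for the leg without its first vertex
    bounds k 2 in terms of k 1 and the end value; inserting this bound into the
    first condition, multiplied by the numerator of the tail, gives the
    claim. *)
Lemma leg_ineq s (k : nat -> rat) : all (fun b : int => 2 <= b) s ->
  (forall j, (j < size s)%N -> (s`_j)%:~R * k j.+1 <= k j + k j.+2) ->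
  (cf_pair s).1%:~R * k 1%N <= (cf_pair s).2%:~R * k 0%N + k (size s).+1.
Proof.
elim: s k => [|b s IHs] k /=; first by rewrite mul1r mul0r add0r.
move=> /andP[_ s2] hk; have /andP[q0 qp] := cf_pair_bounds s2.
have p0 : 0 <= (cf_pair s).1%:~R :> rat by rewrite ler0z (le_trans q0) // ltW.
have := IHs (k \o succn) s2 (fun j => hk j.+1).
have := ler_wpM2l p0 (hk 0%N isT); rewrite /= rmorphB rmorphM /=.
by move: (_%:~R) (_%:~R) (_%:~R) => p q b'; lra.
Qed.

Lemma leg_eq s (k : nat -> rat) : all (fun b : int => 2 <= b) s ->
  (forall j, (j < size s)%N -> (s`_j)%:~R * k j.+1 = k j + k j.+2) ->
  (cf_pair s).1%:~R * k 1%N = (cf_pair s).2%:~R * k 0%N + k (size s).+1.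
Proof.
move=> s2 hk; apply/eqP; rewrite eq_le leg_ineq //=; last first.
  by move=> j /hk ->.
have := @leg_ineq s (fun j => - k j) s2; rewrite !mulrN -!opprD lerN2; apply.
by move=> j /hk; rewrite mulrN -opprD => ->.
Qed.

(** The recursion with equalities, run outwards from the first two values. *)
Fixpoint leg_chain (s : seq int) (a b : int) (j : nat) : int :=
  if j is j'.+1 then leg_chain (behead s) b (head 0 s * b - a) j' else a.

Lemma leg_chainE s a b j :
  leg_chain s a b j.+2 = s`_j * leg_chain s a b j.+1 - leg_chain s a b j.
Proof.
elim: j s a b => [|j IHj] s a b; first by rewrite /= nth0.
by rewrite [LHS]IHj nth_behead.
Qed.

(** * The intersection form of a star-shaped graph *)

Section Star.
Variables (d : nat) (b0 : int) (leg : 'I_d -> seq int).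
Local Notation V := (star_vertex leg).
Local Notation form := (@star_form d b0 leg).
Implicit Types x : {ffun V -> rat}.

Definition leg_vertex i (j : 'I_(size (leg i))) : V :=
  Some (Tagged (fun i => 'I_(size (leg i))) j).

(** The coefficients of x along the i-th leg, as a sequence indexed from the
    centre: index 0 is the central vertex and, after the last vertex of the
    leg, the sequence vanishes. With these boundary values the pairing has the
    same form at every vertex of the leg, see [pairing_leg]. *)
Definition leg_coef x i (j : nat) : rat :=
  if j is j'.+1 then
    if insub j' is Some p then x (@leg_vertex i p) else 0
  else x (star_center leg).

Arguments leg_coef : simpl never.

Lemma leg_coef0 x i : leg_coef x i 0 = x (star_center leg).
Proof. by []. Qed.

Lemma leg_coefS x i (j : 'I_(size (leg i))) :
  leg_coef x i j.+1 = x (leg_vertex j).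
Proof. by rewrite /leg_coef valK. Qed.

Lemma leg_coef_end x i : leg_coef x i (size (leg i)).+1 = 0.
Proof. by rewrite /leg_coef insubN // ltnn. Qed.

Lemma sum_vertex (F : V -> rat) :
  \sum_v F v = F (star_center leg) + \sum_i \sum_j F (@leg_vertex i j).
Proof.
rewrite (bigD1 (star_center leg)) //=; congr (_ + _).
rewrite (sig_big_dep (fun=> true) (fun _ _ => true)
           (fun i j => F (leg_vertex j))) /=.
rewrite (@reindex_omap _ _ _ V _ (@Some _) id (fun v => v != star_center leg));
  last by case.
by apply: eq_big => [p|[i j] _] //=; rewrite eqxx.
Qed.

Lemma sum_leg_delta x i m :
  \sum_(j < size (leg i)) x (leg_vertex j) * (m == j :> nat)%:R
  = leg_coef x i m.+1.
Proof.
have [ltm|gem] := ltnP m (size (leg i)).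
  rewrite (bigD1 (Ordinal ltm)) //= eqxx mulr1 /leg_coef insubT.
  rewrite big1 ?addr0 // => j.
  by rewrite -val_eqE eq_sym => /negPf /= ->; rewrite mulr0.
rewrite /leg_coef insubN -?leqNgt // big1 // => j _.
by rewrite gtn_eqF ?mulr0 // (leq_trans _ gem).
Qed.

Lemma pairing_center x :
  pairing form x (base_cycle (star_center leg))
  = \sum_i leg_coef x i 1 - b0%:~R * x (star_center leg).
Proof.
rewrite pairing_base sum_vertex addrC; congr (_ + _); last first.
  by rewrite /star_form eqxx /= rmorphN mulrN mulrC.
apply: eq_bigr => i _; rewrite -sum_leg_delta; apply: eq_bigr => j _.
by rewrite /star_form /= eq_sym; case: eqP.
Qed.

Lemma pairing_leg x i (j : 'I_(size (leg i))) :
  pairing form x (base_cycle (leg_vertex j))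
  = leg_coef x i j + leg_coef x i j.+2
    - ((leg i)`_j)%:~R * leg_coef x i j.+1.
Proof.
rewrite pairing_base sum_vertex (bigD1 i) //= [X in _ + (_ + X)]big1 ?addr0.
  (* the row of the form is the sum of a diagonal, an outer neighbour and an
     inner neighbour term; for j = 0 the inner neighbour is the centre *)
  have E (m : 'I_(size (leg i))) :
      x (leg_vertex m) * (form (leg_vertex m) (leg_vertex j))%:~R =
      - ((leg i)`_j)%:~R * (x (leg_vertex m) * (j == m :> nat)%:R)
      + x (leg_vertex m) * (j.+1 == m :> nat)%:R
      + x (leg_vertex m) * ((0 < j) && (j.-1 == m))%N%:R.
    rewrite /star_form; have [/Some_inj/eqP|] := eqVneq (leg_vertex m) _.
      rewrite eq_Tagged /= => /eqP ->; rewrite eqxx gtn_eqF //.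
      have -> : ((0 < j) && (j.-1 == j))%N = false.
        by case: (nat_of_ord j) => //= n; rewrite ltn_eqF.
      by rewrite rmorphN /=; ring.
    move=> neq_mj; have /negPf -> : j != m :> nat.
      by apply: contra_neq neq_mj => /val_inj ->.
    have adjE : (m.+1 == j) = ((0 < j) && (j.-1 == m))%N.
      by case: (nat_of_ord j) => //= n; rewrite eqSS eq_sym.
    rewrite /= eqxx adjE /=; have [<-|_] := eqVneq j.+1 m; last first.
      by rewrite orbF; case: (_ && _) => /=; ring.
    have -> : ((0 < j) && (j.-1 == j.+1))%N = false.
      by case: (nat_of_ord j) => //= n; rewrite ltn_eqF // leqW.
    by rewrite orbT /=; ring.
  rewrite (eq_bigr _ (fun m _ => E m)) !big_split /= -mulr_sumr !sum_leg_delta.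
  have -> : \sum_(m < size (leg i))
              x (leg_vertex m) * ((0 < j) && (j.-1 == m))%N%:R
            = if (0 < j)%N then leg_coef x i j else 0.
    case: (posnP j) => [j0|j_gt0]; first by apply: big1 => m _; rewrite mulr0.
    by rewrite -[in RHS](prednK j_gt0) -sum_leg_delta.
  rewrite /star_form /=.
  by case: (nat_of_ord j) => [|n] /=; rewrite ?eqxx ?leg_coef0; ring.
move=> i' neq_i; apply: big1 => m _; rewrite /star_form /= (negPf neq_i).
case: eqP => [/Some_inj/(congr1 tag)/= eq_i|_]; last by rewrite mulr0.
by rewrite eq_i eqxx in neq_i.
Qed.

Lemma star_form_ge0 v w : w != v -> 0 <= form w v.
Proof. by rewrite /star_form => /negPf ->; case: ifP. Qed.

Lemma pairing_base_self v :
  pairing form (base_cycle v) (base_cycle v) = (star_deco b0 v)%:~R.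
Proof.
rewrite pairing_base (bigD1 v) //= ffunE eqxx mul1r /star_form eqxx big1.
  by rewrite addr0.
by move=> w /negPf w_v; rewrite ffunE w_v mul0r.
Qed.

End Star.

(** * Elimination of the legs *)

Section Seifert.
Variables (d : nat) (b0 : int) (alpha omega : 'I_d -> nat).
Variable leg : 'I_d -> seq int.
Hypothesis hco : forall i, coprime (alpha i) (omega i).
Hypothesis hom : forall i, (0 < omega i < alpha i)%N.
Hypothesis hleg2 : forall i, all (fun b : int => 2 <= b) (leg i).
Hypothesis hleg : forall i,
  neg_cont_frac (leg i) = (alpha i)%:R / (omega i)%:R.
Local Notation V := (star_vertex leg).
Local Notation form := (@star_form d b0 leg).
Local Notation center := (star_center leg).
Local Notation e := (orbifold_euler b0 alpha omega).
Implicit Types x l : {ffun V -> rat}.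

Let leg_pair i : cf_pair (leg i) = ((alpha i)%:Z, (omega i)%:Z).
Proof. exact: cf_pair_eq. Qed.

Let alpha_gt0 i : 0 < (alpha i)%:R :> rat.
Proof. by rewrite ltr0n; case/andP: (hom i) => _; apply: leq_ltn_trans. Qed.

(** The parameter t allows for E_0^* (t = 0) and Z_K (t = 1) together: after
    subtraction of t the recursion along the leg is homogeneous and its value
    past the end is -t. *)
Lemma leg_coef1_eq x t i :
  (forall j : 'I_(size (leg i)),
    pairing form x (base_cycle (leg_vertex j)) = t * (2 - ((leg i)`_j)%:~R)) ->
  leg_coef x i 1 - t
  = (omega i)%:R / (alpha i)%:R * (x center - t) - t / (alpha i)%:R.
Proof.
move=> hx.
have := @leg_eq (leg i) (fun j => leg_coef x i j - t) (hleg2 i).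
rewrite leg_pair leg_coef_end /= => E.
have {}E : (alpha i)%:R * (leg_coef x i 1 - t)
           = (omega i)%:R * (x center - t) + (0 - t).
  apply: E => j ltj; have := hx (Ordinal ltj); rewrite pairing_leg /=; lra.
apply: (mulfI (lt0r_neq0 (alpha_gt0 i))); rewrite E; field.
exact: lt0r_neq0.
Qed.

Lemma center_coef_eq x t c :
  (forall i (j : 'I_(size (leg i))),
    pairing form x (base_cycle (leg_vertex j)) = t * (2 - ((leg i)`_j)%:~R)) ->
  pairing form x (base_cycle center) = t * (2 - b0%:~R) + c ->
  e * (x center - t) = t * (2 - d%:R + \sum_i (alpha i)%:R^-1) + c.
Proof.
move=> hx; rewrite pairing_center.
have -> : \sum_i leg_coef x i 1
          = (\sum_i (omega i)%:R / (alpha i)%:R) * (x center - t)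
            - t * (\sum_i (alpha i)%:R^-1) + t * d%:R.
  rewrite mulr_suml mulr_sumr -sumrB -[d%:R]mul1r mulr_natr mulr_natr.
  rewrite -[in t *+ d](card_ord d) -sumr_const -big_split.
  by apply: eq_bigr => i _ /=; rewrite -leg_coef1_eq // subrK.
rewrite /orbifold_euler; move: (\sum_i _ / _) (\sum_i _ ^-1) => S T; lra.
Qed.

Lemma dual_center E0s : is_dual_base form center E0s ->
  e * E0s center = -1.
Proof.
case=> _ hE; have := @center_coef_eq E0s 0 (-1).
rewrite subr0 !mul0r !add0r; apply; last exact: hE.
by move=> i j; rewrite hE mul0r.
Qed.

Lemma anticanonical_center ZK : is_anticanonical form ZK ->
  e * (ZK center - 1) = 2 - d%:R + \sum_i (alpha i)%:R^-1.
Proof.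
case=> _ hZ; have := @center_coef_eq ZK 1 0.
rewrite !mul1r !addr0; apply.
  move=> i j; rewrite hZ pairing_base_self /= rmorphN /=; lra.
rewrite hZ pairing_base_self /= rmorphN /=; lra.
Qed.

(** The E_0-coefficient of the dual cycle is -1/e, and it is also minus the
    self-intersection of that cycle, hence positive. *)
Lemma euler_lt0 E0s : negative_definite form ->
  is_dual_base form center E0s -> e < 0.
Proof.
move=> negA hE; have eE := dual_center hE.
have E0 : E0s <> 0.
  move=> E0; move: eE; rewrite E0 ffunE mulr0 => /eqP.
  by rewrite eq_sym oppr_eq0 oner_eq0.
have := negative_definite_rat negA E0.
rewrite pairing_baseE (bigD1 center) //= hE.2 eqxx big1 => [|v /negPf v0].
  by rewrite addr0; nra.
by rewrite hE.2 v0 mulr0.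
Qed.

(** * Gaps of the semigroup and integral cycles *)

(** The best integer k i is the ceiling of m omega_i / alpha_i minus 1, and with
    this choice the second condition is N(m) <= -1. *)
Lemma seifert_N_lt0P (m : int) :
  reflect (exists2 k : 'I_d -> int,
             forall i, (alpha i)%:Z * k i <= (omega i)%:Z * m - 1
           & 1 <= \sum_i (k i + 1) - b0 * m)
          (seifert_N b0 alpha omega m < 0).
Proof.
have ceilP i (k : int) :
    (k + 1 <= Num.ceil (m%:~R * (omega i)%:R / (alpha i)%:R : rat))
    = ((alpha i)%:Z * k <= (omega i)%:Z * m - 1).
  rewrite lezD1 ceil_gt_int ltr_pdivlMr // lerBrDr lezD1 -(ltr_int rat).
  by rewrite !rmorphM /= [_ * m%:~R]mulrC [k%:~R * _]mulrC.
rewrite /seifert_N; apply: (iffP idP) => [N0|[k hk h1]].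
  exists (fun i => Num.ceil (m%:~R * (omega i)%:R / (alpha i)%:R : rat) - 1).
    by move=> i; rewrite -ceilP subrK.
  by move: N0; rewrite (eq_bigr _ (fun i _ => subrK _ _)) subr_lt0 -lezD1; lra.
have : \sum_i (k i + 1)
       <= \sum_i Num.ceil (m%:~R * (omega i)%:R / (alpha i)%:R : rat).
  by apply: ler_sum => i _; rewrite ceilP.
lra.
Qed.

(** The condition on an integral cycle l which makes Z_K + E_0^* - l antinef. *)
Definition adjunction_bounded l : Prop :=
  forall v, (star_deco b0 v)%:~R + 2 - (v == center)%:R
            <= pairing form l (base_cycle v).

(** Minus 1 in each coefficient makes the leg conditions homogeneous, with -1 as
    the value past the end; [leg_ineq] then yields the first condition of
    [seifert_N_lt0P], and the central vertex yields the second. *)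
Lemma bounded_lattice_coef l : in_lattice l -> adjunction_bounded l ->
  exists2 m : int, l center = m%:~R + 1 & seifert_N b0 alpha omega m < 0.
Proof.
move=> lZ lN.
have coefZ i j : leg_coef l i j - 1 \is a Num.int.
  rewrite rpredB ?rpred1 //; case: j => [|j]; first exact: lZ.
  by rewrite /leg_coef; case: insubP => *; rewrite ?rpred0 ?lZ.
have centerZ : l center - 1 \is a Num.int by rewrite rpredB ?lZ ?rpred1.
exists (Num.floor (l center - 1)); first by rewrite floorK ?subrK.
apply/seifert_N_lt0P; exists (fun i => Num.floor (leg_coef l i 1 - 1)) => [i|].
  rewrite -(ler_int rat) rmorphB !rmorphM /= (floorK centerZ).
  rewrite (floorK (coefZ i 1%N)).
  have := @leg_ineq (leg i) (fun j => leg_coef l i j - 1) (hleg2 i).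
  rewrite leg_pair leg_coef_end sub0r /=; apply => j ltj.
  have := lN (leg_vertex (Ordinal ltj)).
  rewrite pairing_leg /= rmorphN /=; lra.
rewrite -(ler_int rat) rmorphB rmorph_sum rmorphM /= (floorK centerZ).
have := lN center; rewrite pairing_center eqxx /= rmorphN /=.
have -> : \sum_i (Num.floor (leg_coef l i 1 - 1) + 1)%:~R
          = \sum_i leg_coef l i 1.
  by apply: eq_bigr => i _; rewrite rmorphD /= (floorK (coefZ i 1%N)) subrK.
lra.
Qed.

(** Each leg is filled by running its recursion with equalities from m and k i.
    The value past the end is then alpha_i (k i) - omega_i m <= -1, so replacing
    it by -1 preserves the inequality at the last vertex. *)
Lemma exists_bounded_lattice m : seifert_N b0 alpha omega m < 0 ->
  exists l, [/\ in_lattice l, adjunction_bounded l & l center = m%:~R + 1].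
Proof.
case/seifert_N_lt0P => k hk h1.
pose ch i := leg_chain (leg i) m (k i).
pose l : {ffun V -> rat} :=
  [ffun v : V => (if v is Some p then ch (tag p) (tagged p).+1 else m)%:~R + 1].
have l0 : l center = m%:~R + 1 by rewrite ffunE.
have coefE i j : (j <= size (leg i))%N -> leg_coef l i j = (ch i j)%:~R + 1.
  case: j => [_|j ltj]; first by rewrite /= l0.
  by rewrite (leg_coefS l (Ordinal ltj)) ffunE.
have legE i j : ((leg i)`_j)%:~R * (ch i j.+1)%:~R
                = (ch i j)%:~R + (ch i j.+2)%:~R :> rat.
  by rewrite /ch leg_chainE -rmorphM -rmorphD /=; congr (_%:~R); ring.
have endE i : (ch i (size (leg i)).+1)%:~R + 1 <= 0 :> rat.
  have := leg_eq (hleg2 i) (fun j _ => legE i j).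
  rewrite leg_pair /= => E; have := hk i; rewrite -(ler_int rat).
  rewrite rmorphB !rmorphM /=; lra.
have coef_ge i j : (j <= (size (leg i)).+1)%N ->
    (ch i j)%:~R + 1 <= leg_coef l i j.
  rewrite leq_eqVlt ltnS => /predU1P[->|/coefE -> //].
  by rewrite leg_coef_end.
exists l; split=> //.
  by move=> v; rewrite ffunE rpredD ?intr_int ?rpred1.
case=> [[i j]|]; last first.
  rewrite -/center pairing_center eqxx l0 /= rmorphN /=.
  have le_sum : \sum_i ((k i)%:~R + 1) <= \sum_i leg_coef l i 1.
    by apply: ler_sum => i _; apply: (coef_ge i 1%N).
  move: h1; rewrite -(ler_int rat) rmorphB rmorph_sum rmorphM /=.
  rewrite (eq_bigr (fun i => (k i)%:~R + 1)); first lra.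
  by move=> i _; rewrite rmorphD.
rewrite -/(leg_vertex j) pairing_leg.
rewrite (coefE i j (ltnW (ltn_ord j))) (coefE i j.+1 (ltn_ord j)) subr0.
have := coef_ge i j.+2 (ltn_ord j).
have := legE i j; rewrite /= rmorphN /=; lra.
Qed.

End Seifert.

Theorem theorem6p2p3 (d : nat) (b0 : int) (alpha omega : 'I_d -> nat)
    (leg : 'I_d -> seq int)
    (ZK E0s s : {ffun star_vertex leg -> rat})
    (hd : (3 <= d)%N)
    (hco : forall i, coprime (alpha i) (omega i))
    (hom : forall i, (0 < omega i < alpha i)%N)
    (hleg2 : forall i, all (fun b : int => 2 <= b) (leg i))
    (hleg : forall i,
      neg_cont_frac (leg i) = (alpha i)%:R / (omega i)%:R)
    (hneg : negative_definite (@star_form d b0 leg))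
    (hZK : is_anticanonical (@star_form d b0 leg) ZK)
    (hE0s : is_dual_base (@star_form d b0 leg) (star_center leg) E0s)
    (hs : is_min_antinef (@star_form d b0 leg)
            (dual_class (@star_form d b0 leg) (ZK + E0s)) s)
    (hb0 : b0 < d%:Z) :
  exists f : int,
    is_frobenius_number (seifert_semigroup b0 alpha omega) f /\
    f%:~R = seifert_gamma b0 alpha omega
            + `|orbifold_euler b0 alpha omega|^-1
            - s (star_center leg).
Proof.
set c := ZK + E0s in hs; set form := @star_form d b0 leg in hneg hZK hE0s hs.
have cD : in_dual form c by apply: in_dualD; [exact: hZK.1 | exact: hE0s.1].
have cE v : pairing form c (base_cycle v)
            = (star_deco b0 v)%:~R + 2 - (v == star_center leg)%:R.
  rewrite pairingD hZK.2 hE0s.2 pairing_base_self; congr (_ + _).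
  by case: eqP => _; rewrite ?subr0 ?oppr0.
have eE := dual_center hco hom hleg2 hleg hE0s.
have eK := anticanonical_center hco hom hleg2 hleg hZK.
have e0 := euler_lt0 hco hom hleg2 hleg hneg hE0s.
have [sD [_ sZ] sN] := hs.1.1.
have [|v|m mE Nm] :=
  bounded_lattice_coef hco hom hleg2 hleg (l := c - s) (b0 := b0).
- by move=> v; rewrite -opprB ffunE rpredN sZ.
- by rewrite -cE pairingD pairingN lerDl oppr_ge0 sN.
exists m; split; last first.
  (* m + 1 = c_0 - s_0, and c_0 = 1 + gamma + 1 / |e| *)
  move: mE; rewrite !ffunE /seifert_gamma ltr0_norm // => mE.
  set e := orbifold_euler _ _ _ in eE eK e0 *.
  have -> : d%:R - 2 - \sum_i (alpha i)%:R^-1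
            = - e * (ZK (star_center leg) - 1) by lra.
  rewrite mulKf ?oppr_eq0 ?lt_eqF //.
  have -> : (- e)^-1 = E0s (star_center leg).
    by apply: (mulfI (_ : - e != 0)); rewrite ?mulfV ?oppr_eq0 ?lt_eqF //; lra.
  lra.
(* a gap n gives an antinef cycle with E_0-coefficient c_0 - n - 1 >= s_0 *)
split=> [|n Nn]; first by rewrite /seifert_semigroup leNgt Nm.
have {}Nn : seifert_N b0 alpha omega n < 0 by rewrite ltNge; apply/negP.
have [l [lZ lN lE]] := exists_bounded_lattice hco hom hleg2 hleg Nn.
have /(_ (star_center leg)) : cycle_le s (c - l).
  apply: (min_antinef_le _ hs); first exact: star_form_ge0.
  have xZ : in_lattice (c - l - c).
    by move=> v; rewrite addrAC subrr add0r ffunE rpredN lZ.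
  have xD : in_dual form (c - l).
    apply: in_dualD => //; apply: lattice_in_dual => v.
    by rewrite ffunE rpredN lZ.
  split=> // v.
  by rewrite pairingD pairingN subr_le0 cE; apply: lN.
move: mE; rewrite -(ler_int rat) !ffunE lE; lra.
Qed.
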